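(* Let $X$ be a second countable Baire complex topological vector space and $\Gamma$ a subset of $L(X)$. The following assertions are equivalent: (i) $\mathbb{U}C(\Gamma)$ is dense in $X$; (ii) $\Gamma$ is codisk transitive. As a consequence, a codisk transitive set $\Gamma\subset L(X)$ is codiskcyclic.
   Context: $L(X)$ is the set of all continuous linear operators on $X$. Put $\mathbb{U}=\{\alpha\in\mathbb{C} : |\alpha|\geq 1\}$. For $\Gamma\subset L(X)$ and $x\in X$, the codisk orbit of $x$ under $\Gamma$ is $\mathbb{U}Orb(\Gamma,x)=\{\alpha Tx : \alpha\in\mathbb{U},\ T\in\Gamma\}$. The vector $x$ is a codiskcyclic vector for $\Gamma$ if $\mathbb{U}Orb(\Gamma,x)$ is dense in $X$; the set of all codiskcyclic vectors for $\Gamma$ is denoted $\mathbb{U}C(\Gamma)$, and $\Gamma$ is codiskcyclic if $\mathbb{U}C(\Gamma)\neq\emptyset$. $\Gamma$ is codisk transitive if for any pair $(U,V)$ of nonempty open subsets of $X$ there exist $\alpha\in\mathbb{U}$ and $T\in\Gamma$ such that $T(\alpha U)\cap V\neq\emptyset$. *)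

(* Defs.v *)
From HB Require Import structures.
From mathcomp Require Import all_boot all_order all_algebra.
From mathcomp Require Import complex.
From mathcomp Require Import all_classical all_reals all_analysis.

Set Implicit Arguments.
Unset Strict Implicit.
Unset Printing Implicit Defensive.

Import GRing.Theory Num.Theory.

Local Open Scope classical_set_scope.
Local Open Scope ring_scope.
Local Open Scope complex_scope.

Definition baire_space (T : topologicalType) : Prop :=
  forall F : nat -> set T,
    (forall n, open (F n)) -> (forall n, dense (F n)) ->
    dense (\bigcap_n F n).

(* The norm of R[i] takes its values in R[i], whose order is the partial order
   with z <= w iff w - z is a nonnegative real; since `|a| is real,
   1 <= `|a| is the usual comparison of reals. *)
Definition codisk (R : realType) : set R[i] := [set a | 1 <= `|a|].

Section Codisk.
(* topologicalLmodType is a topological vector space with no local convexity or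
   separation assumption (tvsType would impose local convexity). *)
Context (R : realType) (X : topologicalLmodType R[i]).

Definition continuous_operators : set {linear X -> X} :=
  [set T | continuous T].

Implicit Types (Gamma : set {linear X -> X}) (x : X).

Definition codisk_orbit Gamma x : set X :=
  [set a *: (T : {linear X -> X}) x | a in @codisk R & T in Gamma].

Definition codiskcyclic_vectors Gamma : set X :=
  [set x | dense (codisk_orbit Gamma x)].

Definition codiskcyclic Gamma : Prop := codiskcyclic_vectors Gamma !=set0.

Definition codisk_transitive Gamma : Prop :=
  forall U V : set X, open U -> U !=set0 -> open V -> V !=set0 ->
    exists2 a, @codisk R a & exists2 T, Gamma T &
      (T @` [set a *: u | u in U]) `&` V !=set0.

End Codisk.

Arguments continuous_operators {R} X.

(* Main.v *)
Require Import Defs.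
From mathcomp Require Import all_boot all_order all_algebra.
From mathcomp Require Import complex.
From mathcomp Require Import all_classical all_reals all_analysis.

(** This is the Birkhoff transitivity argument. For a set [V], consider the
    vectors whose codisk orbit meets [V] ([orbit_hitting_set]). Since operators
    commute with scalars, codisk transitivity says exactly that this set is
    dense for every nonempty open [V] ([codisk_transitiveP]). A codiskcyclic
    vector lies in all of these sets, so a dense set of such vectors makes each
    of them dense.

    Conversely, continuity of the operators and of scalar multiplication makes
    each of these sets open ([open_orbit_hitting_set]). An orbit is dense as
    soon as it meets every nonempty member of a basis, so with a countable basis
    the set of codiskcyclic vectors is a countable intersection of dense open
    sets ([codiskcyclic_vectorsE]), and the Baire property makes it dense.
    A dense subset of [X] is nonempty because [X] contains [0], whence the
    final consequence. *)

Local Open Scope classical_set_scope.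
Local Open Scope ring_scope.
Local Open Scope complex_scope.

(** A basis of a topology comes as a countable set of sets rather than as a
    sequence, hence this form of the Baire property. *)
Lemma baire_dense_bigcap (T : topologicalType) (I : Type) (D : set I)
    (F : I -> set T) :
  baire_space T -> countable D -> (forall i, D i -> open (F i)) ->
  (forall i, D i -> dense (F i)) -> dense (\bigcap_(i in D) F i).
Proof.
move=> baireT /pfcard_geP[->|[e]] Fopen Fdense.
  by rewrite bigcap_set0 => U U0 _; rewrite setIT.
have De n : D (e n) by exact: (@funS _ _ _ _ e).
have eD : e @` setT = D by exact: image_eq.
rewrite -eD bigcap_image; apply: baireT => n; [exact: Fopen|exact: Fdense].
Qed.

Lemma basis_denseP (T : topologicalType) (B : set (set T)) (S : set T) :
  basis B -> dense S <-> (forall V, B V -> V !=set0 -> V `&` S !=set0).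
Proof.
move=> [Bopen Bnbhs]; split=> [Sdense V BV V0|SB U [u Uu] Uopen].
  by apply: Sdense => //; exact: Bopen.
have [V [BV Vu] VU] := Bnbhs u U (open_nbhs_nbhs (conj Uopen Uu)).
have [x [Vx Sx]] := SB V BV (ex_intro _ u Vu).
by exists x; split=> //; exact: VU.
Qed.

Section OrbitHitting.
Context (R : realType) (X : topologicalLmodType R[i]).
Implicit Types (Gamma : set {linear X -> X}) (V : set X).

Definition orbit_hitting_set Gamma V : set X :=
  [set x | V `&` codisk_orbit Gamma x !=set0].

(** The set is a union of preimages of [V] under the maps [a *: T]. *)
Lemma open_orbit_hitting_set Gamma V :
  Gamma `<=` continuous_operators X -> open V ->
  open (orbit_hitting_set Gamma V).
Proof.
move=> Gcont Vopen.
have -> : orbit_hitting_set Gamma V =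
    \bigcup_(p in @codisk R `*` Gamma) ((fun x => p.1 *: p.2 x) @^-1` V).
  apply/seteqP; split=> x.
    by move=> [y [Vy [a ca [T GT yE]]]]; exists (a, T) => //=; rewrite yE.
  by move=> [[a T] [/= ca GT] VaT]; exists (a *: T x); split=> //; exists a => //;
    exists T.
apply: bigcup_open => -[a T] [/= _ /Gcont Tcont]; apply: open_comp => // x _.
(* Scalar multiplication is jointly continuous, hence continuous along
   the map sending x to the pair (a, T x). *)
apply: (@continuous_comp X (R[i]^o * X)%type X (fun x => (a, T x))
  (fun z => z.1 *: z.2)); last exact: scale_continuous.
by apply: (@cvg_pair _ _ _ _ (nbhs (a : R[i]^o))); [exact: cvg_cst|exact: Tcont].
Qed.

(** Transitivity scales the vectors before applying [T], orbits scale
    afterwards; linearity identifies the two. *)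
Lemma codisk_transitiveP Gamma :
  codisk_transitive Gamma <->
  (forall V, open V -> V !=set0 -> dense (orbit_hitting_set Gamma V)).
Proof.
split=> [Gtr V Vopen V0 U U0 Uopen|Gdense U V Uopen U0 Vopen V0].
  have [a ca [T GT [_ [[_ [u Uu <-] <-] VTu]]]] := Gtr U V Uopen U0 Vopen V0.
  exists u; split=> //; exists (T (a *: u)); split=> //.
  by exists a => //; exists T => //; rewrite GRing.linearZ.
have [u [Uu [y [Vy [a ca [T GT yE]]]]]] := Gdense V Vopen V0 U U0 Uopen.
exists a => //; exists T => //; exists (T (a *: u)); split.
  by exists (a *: u) => //; exists u.
by rewrite GRing.linearZ /= yE.
Qed.

Lemma codiskcyclic_vectorsE Gamma (B : set (set X)) : basis B ->
  codiskcyclic_vectors Gamma =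
  \bigcap_(V in B `&` [set V | V !=set0]) orbit_hitting_set Gamma V.
Proof.
move=> Bbasis; apply/seteqP; split=> x.
  by move=> /(basis_denseP _ _ _ Bbasis) xB V [BV V0]; exact: xB.
by move=> xB; apply/(basis_denseP _ _ _ Bbasis) => V BV V0; exact: xB.
Qed.

End OrbitHitting.

Theorem theorem3p6 (R : realType) (X : topologicalLmodType R[i])
    (X_second_countable : @second_countable X) (X_baire : baire_space X)
    (Gamma : set {linear X -> X})
    (Gamma_continuous : Gamma `<=` continuous_operators X) :
  (dense (codiskcyclic_vectors Gamma) <-> codisk_transitive Gamma) /\
  (codisk_transitive Gamma -> codiskcyclic Gamma).
Proof.
have cyclic_dense :
    codisk_transitive Gamma -> dense (codiskcyclic_vectors Gamma).
  move=> /codisk_transitiveP Gdense.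
  have [B Bcountable Bbasis] := X_second_countable.
  rewrite (codiskcyclic_vectorsE _ _ _ _ Bbasis); apply: baire_dense_bigcap => //.
  - by apply: sub_countable Bcountable; apply: subset_card_le => V [].
  - by move=> V [/Bbasis.1 Vopen _]; exact: open_orbit_hitting_set.
  - by move=> V [/Bbasis.1 Vopen V0]; exact: Gdense.
split; first split=> //.
- move=> UCdense; apply/codisk_transitiveP => V Vopen V0 U U0 Uopen.
  have [x [Ux xcyc]] := UCdense U U0 Uopen.
  by exists x; split=> //; exact: xcyc.
- move=> /cyclic_dense UCdense.
  have [x [_ xcyc]] := UCdense setT (ex_intro _ 0 I) openT.
  by exists x.
Qed.
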